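(* Let $R$ be a UnitUC ring. The following hold: (1) For every $0\neq e\in Id(R)$ and all $u,v\in U(R)$, $u+v\neq e$. In particular, $R$ is a UUC ring. (2) For all $u,v\in U(R)$, $u+v\neq 1$. (3) For all nonzero $e,f\in Id(R)$ and all $u,v\in U(eRe)$, $u+v\neq f$. (4) For every $0\neq e\in Id(R)$ and all $u,v\in U(eRe)$, $u+v\neq e$. (5) For every ideal $I\subseteq J(R)$, $R/I$ is a UnitUC ring. The converse holds provided idempotents lift modulo $I$; that is, if $R$ is any ring and $I\subseteq J(R)$ is an ideal such that $R/I$ is UnitUC and idempotents lift modulo $I$, then $R$ is UnitUC.
   Context: Rings are associative with $1\neq 0$; $J(R)$ is the Jacobson radical, $U(R)$ the group of units, $Id(R)$ the set of idempotents of $R$. For $e\in Id(R)$, $eRe$ is the corner ring with identity $e$. A ring $R$ is clean if every $a\in R$ can be written as $a=e+u$ with $e\in Id(R)$, $u\in U(R)$. For $e,f\in Id(R)$ write $e\sim f$ if there is $u\in U(R)$ with $e=u^{-1}fu$. $R$ is unit uniquely clean (UnitUC) if it is clean and, whenever $e+u=f+v$ with $e,f\in Id(R)$ and $u,v\in U(R)$, one has $e\sim f$. An element $a\in R$ is uniquely clean if there is exactly one $e\in Id(R)$ with $a-e\in U(R)$; $R$ is UUC if every unit of $R$ is uniquely clean. *)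

(* Defs.v *)
From HB Require Import structures.
From mathcomp Require Import all_boot all_order all_algebra.
From mathcomp Require Import boolp classical_sets.

Set Implicit Arguments.
Unset Strict Implicit.
Unset Printing Implicit Defensive.

Import GRing.Theory.
Local Open Scope ring_scope.
Local Open Scope classical_set_scope.
Local Open Scope quotient_scope.

(* The definitions are stated for pzRingType (rings in which 1 = 0 is allowed)
   so that they apply to quotients by arbitrary ideals without a side
   condition. *)

Section RingElements.
Variable R : pzRingType.
Implicit Types a e f u v x y : R.

Definition idem e : Prop := e * e = e.

Definition inverses x y : Prop := y * x = 1 /\ x * y = 1.

Definition isunit x : Prop := exists y, inverses x y.

(* e = u^-1 f u for some unit u, with w in the role of u^-1 *)
Definition idem_sim e f : Prop := exists u w, inverses u w /\ e = w * f * u.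

Definition corner e : set R := [set x | exists r, x = e * r * e].

(* units of the ring eRe, whose identity is e *)
Definition corner_unit e u : Prop :=
  corner e u /\ exists2 w, corner e w & w * u = e /\ u * w = e.

Definition uniquely_clean a : Prop := exists! e, idem e /\ isunit (a - e).

End RingElements.

(* On a unitRingType, isunit is the library's unit predicate. *)
Lemma isunitE (R : unitRingType) (x : R) : isunit x <-> x \is a GRing.unit.
Proof. by split=> [H | /unitrP H]; [apply/unitrP|]. Qed.

Definition clean (R : pzRingType) : Prop :=
  forall a : R, exists e u : R, [/\ idem e, isunit u & a = e + u].

(* The first component is the convention that rings are nonzero; it only
   matters when the ring is not already known to be an nzRingType. *)
Definition unitUC (R : pzRingType) : Prop :=
  [/\ (1 : R) <> 0,
      clean R &
      forall e f u v : R, idem e -> idem f -> isunit u -> isunit v ->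
        e + u = f + v -> idem_sim e f].

Definition UUC (R : pzRingType) : Prop :=
  forall u : R, isunit u -> uniquely_clean u.

Section Jacobson.
Variable R : pzRingType.

Definition left_ideal (M : set R) : Prop :=
  [/\ M 0, forall x y, M x -> M y -> M (x - y) & forall a x, M x -> M (a * x)].

Definition maximal_left_ideal (M : set R) : Prop :=
  [/\ left_ideal M, M <> setT &
      forall N, left_ideal N -> M `<=` N -> N = M \/ N = setT].

Definition jacobson : set R :=
  [set x | forall M, maximal_left_ideal M -> M x].

End Jacobson.

(* MathComp's ring quotients ({ideal_quot _}) are only available for
   commutative rings, hence the following two-sided version on top of the
   library's quotient of additive groups. *)

Record ideal (R : pzRingType) := Ideal {
  ideal_set :> set R;
  ideal0 : ideal_set 0;
  idealB : forall x y, ideal_set x -> ideal_set y -> ideal_set (x - y);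
  idealMl : forall a x, ideal_set x -> ideal_set (a * x);
  idealMr : forall a x, ideal_set x -> ideal_set (x * a) }.

Section RingQuotient.
Variables (R : pzRingType) (I : ideal R).

Definition ideal_mem (x : R) : bool := `[< ideal_set I x >].

Lemma ideal_mem_zmod_closed : zmod_closed ideal_mem.
Proof.
split=> [|x y /asboolP Ix /asboolP Iy]; apply/asboolP; first exact: ideal0.
exact: idealB.
Qed.

Definition ideal_zmodClosed : zmodClosed R :=
  HB.pack ideal_mem (GRing.isZmodClosed.Build R ideal_mem ideal_mem_zmod_closed).

Definition ring_quot : Type := Quotient.quot ideal_zmodClosed.

HB.instance Definition _ := GRing.Zmodule.on ring_quot.

Definition quot_pi (x : R) : ring_quot :=
  \pi_(Quotient.quot ideal_zmodClosed) x.

Lemma quot_pi_surj (c : ring_quot) : exists x, c = quot_pi x.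
Proof. by exists (repr c); rewrite /quot_pi reprK. Qed.

Lemma quot_pi_eq x y : quot_pi x = quot_pi y <-> ideal_set I (x - y).
Proof.
split=> [/eqP|Ixy].
  by rewrite /quot_pi -Quotient.idealrBE => /asboolP.
by apply/eqP; rewrite /quot_pi -Quotient.idealrBE; apply/asboolP.
Qed.

Fact quot_pi_is_zmod_morphism : zmod_morphism quot_pi.
Proof. by move=> x y; rewrite /quot_pi raddfB. Qed.

HB.instance Definition _ :=
  GRing.isZmodMorphism.Build R ring_quot quot_pi quot_pi_is_zmod_morphism.

Definition quot_one : ring_quot := quot_pi 1.
Definition quot_mul (c d : ring_quot) : ring_quot :=
  quot_pi (repr c * repr d).

Lemma repr_quot_pi x : ideal_set I (repr (quot_pi x) - x).
Proof. by apply/quot_pi_eq; rewrite /quot_pi reprK. Qed.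

Lemma quot_piM x y : quot_pi (x * y) = quot_mul (quot_pi x) (quot_pi y).
Proof.
apply/esym/quot_pi_eq; set a := repr _; set b := repr _.
have -> : a * b - x * y = a * (b - y) - - ((a - x) * y).
  by rewrite opprK mulrBr mulrBl addrA subrK.
apply: idealB; first exact/idealMl/repr_quot_pi.
by rewrite -[X in ideal_set I X]sub0r; apply: idealB (ideal0 I) _; apply/idealMr/repr_quot_pi.
Qed.

Fact quot_mulA : associative quot_mul.
Proof.
move=> c d k; have [x ->] := quot_pi_surj c; have [y ->] := quot_pi_surj d.
by have [z ->] := quot_pi_surj k; rewrite -!quot_piM mulrA.
Qed.

Fact quot_mul1r : left_id quot_one quot_mul.
Proof. by move=> c; have [x ->] := quot_pi_surj c; rewrite -quot_piM mul1r. Qed.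

Fact quot_mulr1 : right_id quot_one quot_mul.
Proof. by move=> c; have [x ->] := quot_pi_surj c; rewrite -quot_piM mulr1. Qed.

Fact quot_mulDl : left_distributive quot_mul +%R.
Proof.
move=> c d k; have [x ->] := quot_pi_surj c; have [y ->] := quot_pi_surj d.
have [z ->] := quot_pi_surj k.
by rewrite -raddfD -!quot_piM mulrDl raddfD.
Qed.

Fact quot_mulDr : right_distributive quot_mul +%R.
Proof.
move=> c d k; have [x ->] := quot_pi_surj c; have [y ->] := quot_pi_surj d.
have [z ->] := quot_pi_surj k.
by rewrite -raddfD -!quot_piM mulrDr raddfD.
Qed.

HB.instance Definition _ := GRing.Zmodule_isPzRing.Build ring_quot
  quot_mulA quot_mul1r quot_mulr1 quot_mulDl quot_mulDr.

Fact quot_pi_is_monoid_morphism : monoid_morphism quot_pi.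
Proof. by split=> // x y; rewrite quot_piM. Qed.

HB.instance Definition _ :=
  GRing.isMonoidMorphism.Build R ring_quot quot_pi quot_pi_is_monoid_morphism.

Definition idempotents_lift : Prop :=
  forall c : ring_quot, idem c -> exists2 e : R, idem e & quot_pi e = c.

End RingQuotient.

(* Main.v *)
(* Writing [u + v = e] as [e + (- v) = 0 + u] shows that [e] is similar to [0],
   hence zero; units of a corner [eRe] become units of [R] by adding [1 - e] or
   [-(1 - e)], which reduces the corner statements to this one.  For the
   quotients, units lift modulo [I] because [1 + I] consists of units,
   idempotents lift modulo every ideal of a clean ring, and idempotents that are
   congruent modulo [I] are similar. *)
Require Import Defs.
From mathcomp Require Import all_boot all_order all_algebra.
From mathcomp Require Import boolp classical_sets.

Set Implicit Arguments.
Unset Strict Implicit.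
Unset Printing Implicit Defensive.

Import GRing.Theory.
Local Open Scope ring_scope.
Local Open Scope classical_set_scope.

(** * Units, idempotents and similarity *)

Section Units.
Variable R : pzRingType.
Implicit Types x y z u v w e f g : R.

(** One-sided inverses agree: [y = y * x * z = z]. *)
Lemma isunit_lr x y z : y * x = 1 -> x * z = 1 -> isunit x.
Proof.
move=> yx xz; exists y; split=> //.
by rewrite -[y]mulr1 -xz [y * _]mulrA yx mul1r.
Qed.

Lemma isunitN x : isunit x -> isunit (- x).
Proof. by move=> [y [yx xy]]; exists (- y); split; rewrite mulrNN. Qed.

Lemma idemC e : idem e -> idem (1 - e).
Proof.
by move=> ee; rewrite /idem mulrBl mul1r mulrBr mulr1 ee subrr subr0.
Qed.

Lemma idem_conj u w e : inverses u w -> idem e -> idem (w * e * u).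
Proof.
by move=> [_ uw] ee; rewrite /idem !mulrA -(mulrA (w * e) u) uw
  mulr1 -(mulrA w) ee.
Qed.

Lemma idem_sim_trans e f g : idem_sim e f -> idem_sim f g -> idem_sim e g.
Proof.
move=> [u [u' [[u'u uu'] ->]]] [v [v' [[v'v vv'] ->]]].
exists (v * u), (u' * v'); split; last by rewrite !mulrA.
split; first by rewrite -mulrA (mulrA v') v'v mul1r.
by rewrite -mulrA (mulrA u) uu' mul1r.
Qed.

Lemma idem_sim0 e : idem_sim e 0 -> e = 0.
Proof. by move=> [u [w [_ ->]]]; rewrite mulr0 mul0r. Qed.

End Units.

(** * Sums of two units in a UnitUC ring *)

Section UnitUC.
Variable R : pzRingType.
Hypothesis R_uuc : unitUC R.
Implicit Types e f u v : R.

Lemma unitUC_sum_units_idem e u v :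
  idem e -> isunit u -> isunit v -> u + v = e -> e = 0.
Proof.
case: R_uuc => _ _ sim ee Uu Uv uve; apply: idem_sim0.
apply: (sim e 0 (- v) u) => //; [exact: mulr0 | exact: isunitN |].
by rewrite -uve addrK add0r.
Qed.

(** The idempotent [0] works for [u]; for any other candidate [e], [e = u - (u - e)] is a sum of two
    units, hence zero. *)
Lemma unitUC_UUC : UUC R.
Proof.
move=> u Uu; exists 0; split=> [|e [ee Uue]].
  by split; [exact: mulr0 | rewrite subr0].
apply/esym; apply: (@unitUC_sum_units_idem e u (- (u - e))) => //.
  exact: isunitN.
by rewrite opprB addrC subrK.
Qed.

End UnitUC.

(** * Units of corner rings *)

Section Corner.
Variable R : pzRingType.
Implicit Types e u v : R.

Lemma corner_idl e u : idem e -> corner e u -> e * u = u.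
Proof. by move=> ee [r ->]; rewrite !mulrA ee. Qed.

Lemma corner_idr e u : idem e -> corner e u -> u * e = u.
Proof. by move=> ee [r ->]; rewrite -!mulrA ee. Qed.

(** The inverse is [w + (1 - e)], with [w] the inverse of [u] in the corner: cross terms vanish
    because [1 - e] annihilates the corner on both sides. *)
Lemma corner_unitD e u : idem e -> corner_unit e u -> isunit (u + (1 - e)).
Proof.
move=> ee [eu [w ew [wu uw]]].
have orthl x : corner e x -> (1 - e) * x = 0.
  by move=> ex; rewrite mulrBl mul1r corner_idl // subrr.
have orthr x : corner e x -> x * (1 - e) = 0.
  by move=> ex; rewrite mulrBr mulr1 corner_idr // subrr.
have gg := idemC ee; have eg : e + (1 - e) = 1 by rewrite addrC subrK.
(* Making [1 - e] opaque keeps distributivity from expanding it. *)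
move: (1 - e) gg eg orthl orthr => g gg eg orthl orthr.
exists (w + g); split; rewrite mulrDl !mulrDr.
  by rewrite (orthr w) // (orthl u) // gg addr0 add0r wu.
by rewrite (orthr u) // (orthl w) // gg addr0 add0r uw.
Qed.

Lemma corner_unitN e u : corner_unit e u -> corner_unit e (- u).
Proof.
have cornerN x : corner e x -> corner e (- x).
  by move=> [r ->]; exists (- r); rewrite mulrN mulNr.
move=> [eu [w ew [wu uw]]]; split; first exact: cornerN.
by exists (- w); [exact: cornerN | rewrite !mulrNN].
Qed.

Lemma unitUC_sum_corner_units e f u v : unitUC R -> idem e -> idem f ->
  corner_unit e u -> corner_unit e v -> u + v = f -> f = 0.
Proof.
move=> R_uuc ee ff Uu Uv uvf.
(* The two units are [u + (1 - e)] and [v - (1 - e)]; their sum is still [u + v]. *)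
apply: (unitUC_sum_units_idem R_uuc ff (corner_unitD ee Uu)
  (isunitN (corner_unitD ee (corner_unitN Uv)))).
by rewrite opprD opprK addrACA subrr addr0.
Qed.

End Corner.

(** * Maximal left ideals and the Jacobson radical *)

Section JacobsonUnits.
Variable R : pzRingType.

Lemma left_ideal_maximal (L : set R) : left_ideal L -> ~ L 1 ->
  exists2 M, maximal_left_ideal M & L `<=` M.
Proof.
move=> Lid L1.
(* [Zorn_bigcup] also covers the empty chain, whose union is [set0]: hence the
   property is imposed on [L `|` X] rather than on [X]. *)
pose P (X : set R) := left_ideal (L `|` X) /\ ~ (L `|` X) 1.
have [F FP Ftot|A [[Aid A1] Amax]] := @Zorn_bigcup R P.
  have pick1 x : (L `|` \bigcup_(X in F) X) x ->
      exists2 Z, L `|` Z `<=` L `|` \bigcup_(X in F) X & P Z /\ (L `|` Z) x.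
    move=> [Lx|[X FX Xx]].
      exists set0; first by rewrite setU0; exact: subsetUl.
      by rewrite /P setU0.
    exists X; first by apply: setUS => z Xz; exists X.
    by split; [exact: FP | right].
  (* Since the chain is total, two elements lie in a common member; this gives closure under
     subtraction. *)
  have pick2 x y : (L `|` \bigcup_(X in F) X) x ->
      (L `|` \bigcup_(X in F) X) y ->
      exists2 Z, L `|` Z `<=` L `|` \bigcup_(X in F) X &
        [/\ P Z, (L `|` Z) x & (L `|` Z) y].
    move=> [Lx|[X FX Xx]] Uy.
      have [Z ZU [PZ Zy]] := pick1 y Uy.
      by exists Z => //; split=> //; left.
    have XU : L `|` X `<=` L `|` \bigcup_(X in F) X.
      by apply: setUS => z Xz; exists X.
    case: (Uy) => [Ly|[Y FY Yy]].
      by exists X => //; split; [exact: FP | right | left].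
    have YU : L `|` Y `<=` L `|` \bigcup_(X in F) X.
      by apply: setUS => z Yz; exists Y.
    have [XY|YX] := Ftot X Y FX FY.
      by exists Y => //; split; [exact: FP | right; apply: XY | right].
    by exists X => //; split; [exact: FP | right | right; apply: YX].
  split; last first.
    by move=> /pick1[Z _ [[_ Z1] /Z1]].
  split; first by left; case: Lid.
    move=> x y Ux Uy; have [Z ZU [[[_ ZB _] _] Zx Zy]] := pick2 x y Ux Uy.
    exact/ZU/ZB.
  move=> a x Ux; have [Z ZU [[[_ _ ZM] _] Zx]] := pick1 x Ux.
  exact/ZU/ZM.
exists (L `|` A); last exact: subsetUl.
split=> // [LAT|N Nid LAN]; first by apply: A1; rewrite LAT.
(* If [N] contains [1], it is everything; otherwise [N] satisfies [P], and maximality of [A] forces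
   it inside [A]. *)
have [N1|N1] := pselect (N 1).
  right; apply/seteqP; split=> // x _; rewrite -[x]mulr1.
  by case: Nid => _ _; apply.
have LN : L `<=` N by apply: subset_trans LAN; exact: subsetUl.
have AN : A `<=` N by apply: subset_trans LAN; exact: subsetUr.
left; apply/seteqP; split=> //; apply: subset_trans (@subsetUr _ L A).
apply: contrapT => NA; apply: (Amax N); first by split.
by rewrite /P; have -> : L `|` N = N by exact/setUidPr.
Qed.

(** If the left ideal generated by [1 + x] were proper, a maximal left ideal above it would contain
    [x], hence [1]. *)
Lemma jacobson_left_inverse (x : R) : jacobson x ->
  exists y, y * (1 + x) = 1.
Proof.
move=> Jx; pose L : set R := [set y | exists a, y = a * (1 + x)].
have Lid : left_ideal L.
  split=> [|_ _ [a ->] [b ->]|a _ [b ->]]; first by exists 0; rewrite mul0r.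
    by exists (a - b); rewrite mulrBl.
  by exists (a * b); rewrite mulrA.
have [[y y1]|L1] := pselect (L 1); first by exists y.
have [M Mmax LM] := left_ideal_maximal Lid L1.
have Mx := Jx M Mmax; case: Mmax => -[_ MB MM] MT _; case: MT.
apply/seteqP; split=> // z _; rewrite -[z]mulr1; apply: MM.
rewrite -(addrK x 1); apply: MB => //; apply: LM.
by exists 1; rewrite mul1r.
Qed.

(** * Units and idempotents modulo an ideal inside the radical *)

Variable I : ideal R.
Hypothesis IJ : I `<=` @jacobson R.

Lemma idealN x : ideal_set I x -> ideal_set I (- x).
Proof. by rewrite -sub0r; apply: idealB; exact: ideal0. Qed.

Lemma isunit1D x : ideal_set I x -> isunit (1 + x).
Proof.
move=> Ix; have [y yx] := jacobson_left_inverse (IJ Ix).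
(* [y = 1 - y x] is again in [1 + I], so it has a left inverse too. *)
have yE : y = 1 + - (y * x) by rewrite -yx mulrDr mulr1 addrK.
have Iyx : ideal_set I (- (y * x)) by apply/idealN/idealMl.
have [z] := jacobson_left_inverse (IJ Iyx); rewrite -yE => zy.
have zE : z = 1 + x by rewrite -[z]mulr1 -{1}yx mulrA zy mul1r.
by exists y; split=> //; rewrite -zE.
Qed.

Lemma isunit_congr1 x : ideal_set I (x - 1) -> isunit x.
Proof. by move=> /isunit1D; rewrite addrC subrK. Qed.

Lemma quot_pi1 : quot_pi I 1 = 1. Proof. by []. Qed.

(** If [y] lifts an inverse of the class of [x], then [y * x] and [x * y] lie in [1 + I], so both
    are units and [x] is invertible on each side. *)
Lemma isunit_quot_pi x : isunit (quot_pi I x) <-> isunit x.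
Proof.
split=> [[c [cx xc]]|[y [yx xy]]]; last first.
  by exists (quot_pi I y); split; rewrite -rmorphM ?yx ?xy.
have [y cE] := quot_pi_surj c; rewrite {c}cE in cx xc.
have [a [ayx _]] : isunit (y * x).
  by apply/isunit_congr1/quot_pi_eq; rewrite rmorphM cx.
have [b [_ xyb]] : isunit (x * y).
  by apply/isunit_congr1/quot_pi_eq; rewrite rmorphM xc.
by apply: (@isunit_lr _ x (a * y) (y * b)); rewrite ?mulrA // -mulrA.
Qed.

Lemma idem_quot_pi e : idem e -> idem (quot_pi I e).
Proof. by rewrite /idem -rmorphM => ->. Qed.

Lemma idem_sim_quot_pi e f : idem_sim e f ->
  idem_sim (quot_pi I e) (quot_pi I f).
Proof.
move=> [u [w [[wu uw] ->]]]; exists (quot_pi I u), (quot_pi I w).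
by rewrite !rmorphM; split=> //; split; rewrite -rmorphM ?wu ?uw.
Qed.

(** The element [t] is congruent to [1] modulo [I], hence a unit, and it intertwines the
    idempotents: [f * t = f * e = t * e]. *)
Lemma idem_congr_sim e f : idem e -> idem f -> ideal_set I (e - f) ->
  idem_sim e f.
Proof.
move=> ee ff Ief; pose t := f * e + (1 - f) * (1 - e).
have fe : quot_pi I e = quot_pi I f by apply/quot_pi_eq.
have [w [wt tw]] : isunit t.
  apply/isunit_congr1/quot_pi_eq; rewrite rmorphD !rmorphM !rmorphB /= fe.
  rewrite -!rmorphB -!rmorphM /= ff (idemC ff) -rmorphD /=.
  by rewrite addrC subrK.
exists t, w; split=> //.
have ft : f * t = f * e.
  by rewrite mulrDr !mulrA ff [f * (1 - f)]mulrBr mulr1 ff subrr mul0r addr0.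
have te : t * e = f * e.
  by rewrite mulrDl -!mulrA ee [(1 - e) * e]mulrBl mul1r ee subrr mulr0 addr0.
by rewrite -mulrA ft -te mulrA wt mul1r.
Qed.

(** The conjugating unit lifts to a unit [u] with inverse [w]; then [e] is congruent to the
    conjugate [w * f * u] of [f], hence similar to it. *)
Lemma idem_sim_quot_lift e f : idem e -> idem f ->
  idem_sim (quot_pi I e) (quot_pi I f) -> idem_sim e f.
Proof.
move=> ee ff [c [d [cd eE]]].
have [u cE] := quot_pi_surj c; rewrite {c}cE in cd eE.
have [w wu] : isunit u by apply/isunit_quot_pi; exists d.
have dE : d = quot_pi I w.
  case: cd wu => [dc _] [_ uw].
  by rewrite -[LHS]mulr1 -quot_pi1 -uw rmorphM mulrA dc mul1r.
apply: (@idem_sim_trans _ _ (w * f * u)); last by exists u, w.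
apply: idem_congr_sim => //; first exact: idem_conj.
by apply/quot_pi_eq; rewrite !rmorphM /= -dE.
Qed.

(* If [x = e + u] then [u (x - u^-1 (1 - e) u) = x^2 - x]. *)
Lemma clean_idempotents_lift : clean R -> idempotents_lift I.
Proof.
move=> Rclean c; have [x ->] := quot_pi_surj c => xx.
have [e [u [ee [w [wu uw]] xE]]] := Rclean x.
exists (w * (1 - e) * u); first by apply: idem_conj; [split | exact: idemC].
apply/quot_pi_eq; rewrite -[X in ideal_set I X]mul1r -{1}wu -mulrA.
apply: idealMl.
suff -> : u * (w * (1 - e) * u - x) = - (x * x - x).
  by apply/idealN/quot_pi_eq; rewrite rmorphM.
rewrite mulrBr !mulrA uw mul1r opprB xE mulrBl mul1r !mulrDl !mulrDr ee.
rewrite !opprD !addrA.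
by rewrite [e + u]addrC -[u + e - e]addrA subrr addr0.
Qed.

End JacobsonUnits.

(** * Passing between a ring and its quotient *)

Lemma unitUC_quot (R : nzRingType) (I : ideal R) :
  I `<=` @jacobson R -> unitUC R -> unitUC (ring_quot I).
Proof.
move=> IJ [_ Rclean sim]; split.
(* Otherwise [1] lies in [I], which makes [1 - 1 = 0] a unit. *)
- move=> one0; have /quot_pi_eq : quot_pi I 1 = quot_pi I 0 by rewrite raddf0.
  rewrite subr0 => /idealN/(isunit1D IJ).
  by rewrite subrr => -[y [/eqP]]; rewrite mulr0 eq_sym oner_eq0.
- move=> c; have [a ->] := quot_pi_surj c; have [e [u [ee Uu ->]]] := Rclean a.
  exists (quot_pi I e), (quot_pi I u).
  by split; [exact: idem_quot_pi | exact/isunit_quot_pi | rewrite rmorphD].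
- move=> ce cf c d /(@clean_idempotents_lift _ I Rclean)[e ee {ce}<-].
  move=> /(@clean_idempotents_lift _ I Rclean)[f ff {cf}<-].
  have [u ->] := quot_pi_surj c; have [v ->] := quot_pi_surj d.
  move=> /(isunit_quot_pi IJ) Uu Uv euv; apply: idem_sim_quot_pi.
  (* The lift [v] satisfies the equation only modulo [I]; [e + u - f] has the same class and
     satisfies it exactly. *)
  apply: (sim e f u (e + u - f)) => //; last by rewrite [RHS]addrC subrK.
  apply/(isunit_quot_pi IJ).
  by rewrite rmorphB rmorphD euv addrC addKr.
Qed.

Lemma unitUC_quot_lift (R : nzRingType) (I : ideal R) :
  I `<=` @jacobson R -> unitUC (ring_quot I) -> idempotents_lift I -> unitUC R.
Proof.
move=> IJ [_ Qclean sim] lift; split.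
- by apply/eqP; exact: oner_neq0.
- move=> a; have [_ [c [/lift[e ee <-] Uc aE]]] := Qclean (quot_pi I a).
  (* Only the idempotent is lifted; [a - e] is a unit because its class is the unit [c]. *)
  exists e, (a - e); split=> //; last by rewrite addrC subrK.
  by apply/(isunit_quot_pi IJ); rewrite rmorphB /= aE addrC addKr.
- move=> e f u v ee ff Uu Uv euv; apply: (idem_sim_quot_lift IJ) => //.
  apply: (sim _ _ (quot_pi I u) (quot_pi I v)).
  + exact: idem_quot_pi.
  + exact: idem_quot_pi.
  + exact/isunit_quot_pi.
  + exact/isunit_quot_pi.
  + by rewrite -!rmorphD euv.
Qed.

Theorem proposition2p7 (R : nzRingType) :
  (unitUC R ->
     ((forall e u v : R, idem e -> e <> 0 -> isunit u -> isunit v ->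
         u + v <> e) /\ UUC R) /\
     (forall u v : R, isunit u -> isunit v -> u + v <> 1) /\
     (forall e f u v : R, idem e -> e <> 0 -> idem f -> f <> 0 ->
        corner_unit e u -> corner_unit e v -> u + v <> f) /\
     (forall e u v : R, idem e -> e <> 0 ->
        corner_unit e u -> corner_unit e v -> u + v <> e) /\
     (forall I : ideal R, I `<=` @jacobson R -> unitUC (ring_quot I))) /\
  (forall I : ideal R, I `<=` @jacobson R ->
     unitUC (ring_quot I) -> idempotents_lift I -> unitUC R).
Proof.
split=> [R_uuc|I IJ]; last exact: unitUC_quot_lift.
split; [split|split; [|split; [|split]]].
- move=> e u v ee e0 Uu Uv uve; apply: e0.
  exact: unitUC_sum_units_idem uve.
- exact: unitUC_UUC.
- move=> u v Uu Uv uv1.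
  have /eqP := unitUC_sum_units_idem R_uuc (mulr1 1) Uu Uv uv1.
  by rewrite oner_eq0.
- move=> e f u v ee _ ff f0 Uu Uv uvf; apply: f0.
  exact: (unitUC_sum_corner_units R_uuc ee ff Uu Uv).
- move=> e u v ee e0 Uu Uv uve; apply: e0.
  exact: (unitUC_sum_corner_units R_uuc ee ee Uu Uv).
- by move=> I IJ; exact: unitUC_quot.
Qed.
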